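(* Let $n\in\mathbb N$ be fixed, $\mathbb H=L^2(\mathbb R)$ with norm $\|\cdot\|$, $(\mathcal Af)(x)=f(x+1)$, $g_n=\sum_{k=0}^nk!\,\kappa_{n,k}\mathbb 1_{[-k,-k+1]}$, $\bar{\mathcal A}_n:=\mathcal A-\beta\langle g_n,\cdot\rangle\mathbb 1_{[0,1]}$, and let $\|\bar{\mathcal A}_n\|_{\mathcal L}$ denote its operator norm. Define, for $t\in[0,T]$ and $M\in\mathbb N$, $$\hat u_n(t)=\frac{\alpha a_2}{2a_1}\langle g_n,e^{(T-t)\bar{\mathcal A}_n}\mathbb 1_{[0,1]}\rangle,\qquad \hat u_{n,M}(t)=\frac{\alpha a_2}{2a_1}\Big\langle g_n,\sum_{k=0}^M\frac{(T-t)^k}{k!}\bar{\mathcal A}_n^k\mathbb 1_{[0,1]}\Big\rangle.$$ Then for every $t\in[0,T]$ with $M\ge(T-t)\|\bar{\mathcal A}_n\|_{\mathcal L}$, $$|\hat u_n(t)-\hat u_{n,M}(t)|\le\frac{\alpha a_2}{2a_1}\|g_n\|\,e^{(T-t)\|\bar{\mathcal A}_n\|_{\mathcal L}}\Big(1-e^{-\frac{(T-t)\|\bar{\mathcal A}_n\|_{\mathcal L}}{M+1}}\Big).$$ Moreover, for $M\ge T\|\bar{\mathcal A}_n\|_{\mathcal L}$, $$\sup_{t\in[0,T]}|\hat u_n(t)-\hat u_{n,M}(t)|\le\frac{\alpha a_2}{2a_1}\|g_n\|\,e^{T\|\bar{\mathcal A}_n\|_{\mathcal L}}\Big(1-e^{-\frac{T\|\bar{\mathcal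 A}_n\|_{\mathcal L}}{M+1}}\Big),$$ and the right-hand side tends to $0$ as $M\to\infty$.
   Context: $T>0$, $\alpha,\beta>0$, $a_1,a_2>0$ are constants. $\kappa_{n,k}$ are the coefficients of the Bernstein polynomial approximation $K_n(t)=\frac{1}{T^n}\sum_{k=0}^nK\big(\frac{Tk}{n}\big)\binom nk t^k(T-t)^{n-k}=\sum_{k=0}^n\kappa_{n,k}t^k$ of a continuous kernel $K$ on $[0,T]$, i.e. $\kappa_{n,k}=\frac{1}{T^k}\sum_{i=0}^k(-1)^{k-i}K\big(\frac{iT}{n}\big)\binom ni\binom{n-i}{k-i}$. *)

(* Defs.v *)
From HB Require Import structures.
From mathcomp Require Import all_boot all_order all_algebra.
From mathcomp Require Import all_classical all_reals all_analysis.
Set Implicit Arguments. Unset Strict Implicit. Unset Printing Implicit Defensive.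
Import Order.TTheory GRing.Theory Num.Theory numFieldNormedType.Exports.
Local Open Scope classical_set_scope.
Local Open Scope ring_scope.

Section Defs.
Variable R : realType.

Definition inL2 (f : R -> R) : Prop :=
  measurable_fun setT f /\
  (\int[@lebesgue_measure R]_x ((f x) ^+ 2)%:E < +oo)%E.

Definition ip (f g : R -> R) : R :=
  Rintegral (@lebesgue_measure R) setT (fun x => f x * g x).
Definition L2norm (f : R -> R) : R := Num.sqrt (ip f f).

(* Coefficients of the Bernstein polynomial approximation of K. *)
Definition kappa (K : R -> R) (T : R) (n k : nat) : R :=
  (T ^+ k)^-1 * \sum_(i < k.+1)
     (-1) ^+ (k - i) * K (i%:R * T / n%:R) * ('C(n, i) * 'C(n - i, k - i))%:R.

Definition g_n (K : R -> R) (T : R) (n : nat) : R -> R :=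
  fun x => \sum_(k < n.+1)
     (k`!)%:R * kappa K T n k * \1_(`[(- k%:R), (- k%:R + 1)]) x.

Definition ind01 : R -> R := fun x => \1_(`[0, 1]) x.

Definition Abar (K : R -> R) (T beta : R) (n : nat) (f : R -> R) : R -> R :=
  fun x => f (x + 1) - beta * ip (g_n K T n) f * ind01 x.

Definition Abar_norm (K : R -> R) (T beta : R) (n : nat) : R :=
  sup [set L2norm (Abar K T beta n f) | f in [set f | inL2 f /\ L2norm f <= 1]].

Definition expAbar_partial (K : R -> R) (T beta : R) (n M : nat) (tau : R)
  : R -> R :=
  fun x => \sum_(k < M.+1)
     tau ^+ k / (k`!)%:R * iter k (Abar K T beta n) ind01 x.

Definition u_hatM (K : R -> R) (T alpha beta a1 a2 : R) (n M : nat) (t : R) : R :=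
  alpha * a2 / (2 * a1) * ip (g_n K T n) (expAbar_partial K T beta n M (T - t)).

(* <g_n, e^{(T-t) Abar_n} 1_{[0,1]}>, the exponential of the bounded operator
   being the norm-convergent series; by continuity of the inner product this
   is the limit of the inner products with the partial sums. *)
Definition u_hat (K : R -> R) (T alpha beta a1 a2 : R) (n : nat) (t : R) : R :=
  alpha * a2 / (2 * a1) *
    limn (fun M => ip (g_n K T n) (expAbar_partial K T beta n M (T - t))).

End Defs.

(* Main.v *)
Require Import Defs.
From HB Require Import structures.
From mathcomp Require Import all_boot all_order all_algebra.
From mathcomp Require Import all_classical all_reals all_analysis.
From mathcomp Require Import measurable_realfun ring lra.
Import Order.TTheory GRing.Theory Num.Theory numFieldNormedType.Exports.
Local Open Scope classical_set_scope.
Local Open Scope ring_scope.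

(** With [x = (T - t) * N], where [N] is the operator norm, Cauchy-Schwarz bounds
    the [k]-th term of the exponential series by [|g_n| * x ^ k / k!], so the
    error is at most [|g_n|] times the Taylor remainder of [exp] at [x], and it
    remains to see that [exp (- x / (M + 1)) <= P x], where
    [P x = exp (- x) * \sum_(k <= M) x ^ k / k!] is the probability that a
    Poisson variable of mean [x] is at most [M].  This holds up to
    [x = M + 1]: there is equality at [0]; the inequality at [M + 1] follows by
    induction on [M]; and in between the derivative of
    [P x - exp (- x / (M + 1))] changes sign at most once, from positive to
    negative. *)

(** * The Poisson distribution function *)

(** The derivative of [expR (- x) * x ^ k / k!] is the difference of the terms of index [k - 1] and
    [k], so the sum telescopes and only the top term survives. *)
Lemma is_derive_poisson_cdf (R : realType) (M : nat) (x : R) :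
  is_derive x 1 (fun y => expR (- y) * \sum_(k < M.+1) (y ^+ k / k`!%:R))
    (- (expR (- x) * (x ^+ M / M`!%:R))).
Proof.
elim: M => [|M IH].
  rewrite (_ : (fun y => _) = expR \o -%R); last first.
    by apply/funext => y; rewrite big_ord1 expr0 fact0 divr1 mulr1.
  apply: is_derive_eq; rewrite expr0 fact0 divr1 mulr1 /=.
  by rewrite mulrN1.
have hN : is_derive x 1 (expR \o -%R : R -> R) (- expR (- x)).
  by apply: is_derive_eq; rewrite mulrN1.
rewrite (_ : (fun y => _) =
   (fun y => expR (- y) * \sum_(k < M.+1) (y ^+ k / k`!%:R)) +
   ((M.+1)`!%:R^-1 *: ((expR \o -%R) * (@id R) ^+ M.+1))); last first.
  apply/funext => y; rewrite big_ord_recr /= mulrDr; congr (_ + _).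
  rewrite /= mulrA mulrC; congr (_ * (_ * _)).
  by rewrite exprfctE.
have hX := is_deriveM hN (is_deriveX M.+1 (is_derive_id x 1)).
apply: (is_derive_eq (is_deriveD IH (is_deriveZ (M.+1)`!%:R^-1 hX))).
have M1 : (M.+1)%:R != 0 :> R by rewrite pnatr_eq0.
have Mf : (M`!)%:R != 0 :> R by rewrite pnatr_eq0 -lt0n fact_gt0.
rewrite factS natrM exprfctE /GRing.scale /= exprS.
by field; rewrite Mf nat1r M1.
Qed.

Lemma poisson_cdf_MVT (R : realType) (M : nat) (a b : R) : a <= b ->
  exists2 c, c \in `[a, b] &
    expR (- b) * (\sum_(k < M.+1) (b ^+ k / k`!%:R)) -
    expR (- a) * (\sum_(k < M.+1) (a ^+ k / k`!%:R)) =
    - (expR (- c) * (c ^+ M / M`!%:R)) * (b - a).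
Proof.
move=> ab; apply: (@MVT_segment R
  (fun y => expR (- y) * (\sum_(k < M.+1) (y ^+ k / k`!%:R)))
  (fun y => - (expR (- y) * (y ^+ M / M`!%:R))) _ _ ab) => [x _|].
  exact: is_derive_poisson_cdf.
apply: derivable_within_continuous => x _.
by have [] := is_derive_poisson_cdf R M x.
Qed.

(* [y * exp (- y / a)] increases up to its maximum at [y = a], then decreases;
   the sign condition covers both sides. *)
Lemma ler_mul_expRN (R : realType) (a u v : R) : 0 < a -> 0 <= u ->
  0 <= (v - u) * (u - a) -> v * expR (- (v / a)) <= u * expR (- (u / a)).
Proof.
move=> a0 u0 uv.
(* By [1 + z <= expR z] at [z = (v - u) / a]; the sign condition says exactly that
   [v <= u * (1 + z)]. *)
have h : v <= u * expR ((v - u) / a).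
  apply: (@le_trans _ _ (u * (1 + (v - u) / a))); last first.
    exact: ler_wpM2l (expR_ge1Dx _).
  rewrite -subr_ge0.
  have -> : u * (1 + (v - u) / a) - v = (v - u) * (u - a) / a.
    by field; rewrite gt_eqF.
  by rewrite divr_ge0 // ltW.
have -> : - (u / a) = (v - u) / a + - (v / a) by field; rewrite gt_eqF.
by rewrite expRD mulrA ler_wpM2r // expR_ge0.
Qed.

(** Equality holds at [M = 0], and the right-hand side does not decrease with [M]. *)
Lemma poisson_cdf_mean (R : realType) (M : nat) :
  expR (-1) <=
  expR (- M.+1%:R) * \sum_(k < M.+1) ((M.+1%:R : R) ^+ k / k`!%:R).
Proof.
elim: M => [|M IH].
  by rewrite big_ord1 expr0 fact0 divr1 mulr1.
apply: (le_trans IH).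
(* From [M.+1] to [M.+2] the distribution function loses at most the
   Poisson weight of [M.+1], which is the term gained by the sum. *)
have [|c] := @poisson_cdf_MVT R M.+1 M.+1%:R M.+2%:R; first by rewrite ler_nat.
rewrite in_itv /= => /andP[Mc _].
rewrite (_ : M.+2%:R - M.+1%:R = 1); last by rewrite -natrB // subSnn.
rewrite mulr1 => /(canRL (subrK _)) ->.
rewrite [in leRHS]big_ord_recr /= mulrDr addrCA lerDl addrC subr_ge0.
rewrite !mulrA ler_wpM2r ?invr_ge0 //.
(* Both weights become powers of order [M.+1] of [y * expR (- (y / M.+1))], which is maximal at
   [y = M.+1]. *)
have e (x : R) : expR (- x) = expR (- (x / M.+1%:R)) ^+ M.+1.
  by rewrite -expRM_natl; congr expR; field; rewrite nat1r pnatr_eq0.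
rewrite (e c) (e M.+1%:R) -!exprMn lerXn2r // ?nnegrE ?mulr_ge0 ?expR_ge0 //.
  exact: le_trans Mc.
rewrite ![expR _ * _]mulrC ler_mul_expRN //.
by rewrite mulr_ge0 ?subr_ge0 // subrr.
Qed.

Lemma poisson_cdf_ge (R : realType) (M : nat) (x : R) :
  0 <= x -> x <= M.+1%:R ->
  expR (- (x / M.+1%:R)) <=
  expR (- x) * \sum_(k < M.+1) (x ^+ k / k`!%:R).
Proof.
move=> x0 xM; set a : R := M.+1%:R.
have a0 : 0 < a by rewrite ltr0n.
pose E y : R := expR (- (y / a)).
pose D y := expR (- y) * (\sum_(k < M.+1) (y ^+ k / k`!%:R)) - E y.
(* The derivative of [D], factored through [expR (- y) = E y ^+ M.+1]: its sign depends on [y * E y]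
   alone. *)
pose dD y := E y * (a^-1 - (y * E y) ^+ M / M`!%:R).
have dE (y : R) : is_derive y 1 E (- (E y / a)).
  have -> : E = expR \o (- a^-1 \*: @id R).
    by apply/funext => z; rewrite /E /= /GRing.scale /= mulNr mulrC.
  have h := is_deriveZ (- a^-1) (is_derive_id y (1 : R)).
  apply: (is_derive_eq (is_derive1_comp (is_derive_expR _) h)).
  by rewrite /E /= /GRing.scale /= mulr1 mulNr mulrN [_ / a]mulrC.
have dDP (y : R) : is_derive y 1 D (dD y).
  apply: (is_derive_eq (is_deriveB (is_derive_poisson_cdf R M y) (dE y))).
  have -> : expR (- y) = E y ^+ M.+1.
    by rewrite -expRM_natl; congr expR; rewrite -/a; field; rewrite gt_eqF.
  by rewrite /dD exprMn exprS opprK; ring.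
have mvt (u v : R) : u <= v ->
    exists2 c, c \in `[u, v] & D v - D u = dD c * (v - u).
  move=> uv; apply: (@MVT_segment R D dD _ _ uv).
  by apply: derivable_within_continuous => y _; by have [] := dDP y.
(* If [D x < 0], the mean value theorem gives a point before [x] with
   [dD < 0] and one after [x] with [dD > 0], but [y * E y] increases on [[0, a]]. *)
rewrite -subr_ge0 -/(D x) leNgt; apply/negP => Dx.
have D0 : D 0 = 0.
  rewrite /D /E mul0r oppr0 expR0 mul1r big_ord_recl expr0 fact0 divr1.
  by rewrite big1 ?addr0 ?subrr // => i _; rewrite exprS !mul0r.
have Da : 0 <= D a.
  by rewrite subr_ge0 /E divff ?gt_eqF // poisson_cdf_mean.
have [c + Dc] := mvt _ _ x0; have [e + De] := mvt _ _ xM.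
rewrite !in_itv /= => /andP[xe ea] /andP[c0 cx].
have dc : dD c < 0.
  rewrite ltNge; apply/negP => dc; have : 0 <= D x - D 0.
    by rewrite Dc mulr_ge0 // subr_ge0.
  by rewrite D0 subr0 leNgt Dx.
have de : 0 < dD e.
  rewrite ltNge; apply/negP => de; have : D a - D x <= 0.
    by rewrite De mulr_le0_ge0 // subr_ge0.
  by rewrite leNgt subr_gt0 (lt_le_trans Dx).
move: dc de; rewrite /dD pmulr_rlt0 ?expR_gt0 // pmulr_rgt0 ?expR_gt0 //.
rewrite subr_lt0 subr_gt0 => ac ea1; move: (lt_trans ea1 ac).
rewrite ltNge => /negP; apply.
rewrite ler_wpM2r ?invr_ge0 // lerXn2r // ?nnegrE ?mulr_ge0 ?expR_ge0 //.
  by rewrite (le_trans x0).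
rewrite ler_mul_expRN //; first by rewrite (le_trans x0).
rewrite mulr_le0 // subr_le0 //; exact: le_trans xe.
Qed.

(** * The space [L2] *)

(** Domination: [|f g| <= f ^ 2 + g ^ 2]. *)
Lemma inL2M_integrable (R : realType) (f g : R -> R) : inL2 f -> inL2 g ->
  (@lebesgue_measure R).-integrable setT (EFin \o (fun x => f x * g x)).
Proof.
have sq (h : R -> R) : inL2 h ->
    (@lebesgue_measure R).-integrable setT (EFin \o (fun x => h x ^+ 2)).
  move=> [mh ih]; apply/integrableP; split.
    by apply/measurable_EFinP; apply: measurable_funX.
  by under eq_integral do rewrite /= ger0_norm ?sqr_ge0 //.
move=> Lf Lg; have := integrableD measurableT (sq _ Lf) (sq _ Lg).
apply: le_integrable => //.
  by apply/measurable_EFinP; apply: measurable_funM; [case: Lf|case: Lg].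
move=> x _ /=; rewrite lee_fin [leRHS]ger0_norm ?addr_ge0 ?sqr_ge0 //.
rewrite normrM -[f x ^+ 2]real_normK ?num_real // -[g x ^+ 2]real_normK ?num_real //.
rewrite -subr_ge0.
have := sqr_ge0 (`|f x| - `|g x|); have := mulr_ge0 (normr_ge0 (f x)) (normr_ge0 (g x)).
by nra.
Qed.

(** Expanding the square leaves products of two square-integrable functions. The shape [a * f + g]
    treats sums and multiples together. *)
Lemma inL2_lin (R : realType) (a : R) (f g : R -> R) : inL2 f -> inL2 g ->
  inL2 (fun x => a * f x + g x).
Proof.
move=> Lf Lg; have [mf _] := Lf; have [mg _] := Lg; split.
  by apply: measurable_funD => //; apply: measurable_funM.
have i := inL2M_integrable.
have : (@lebesgue_measure R).-integrable setT (EFin \o (fun x =>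
    a ^+ 2 * (f x * f x) + (a *+ 2 * (f x * g x) + g x * g x))).
  exact: (integrableD measurableT
    (integrableZl measurableT (a ^+ 2) (i _ _ _ Lf Lf))
    (integrableD measurableT
      (integrableZl measurableT (a *+ 2) (i _ _ _ Lf Lg)) (i _ _ _ Lg Lg))).
move=> /integrableP[_]; apply: le_lt_trans.
apply: ge0_le_integral => //= [x _|||x _].
- by rewrite lee_fin sqr_ge0.
- apply/measurable_EFinP; apply: measurable_funX.
  by apply: measurable_funD => //; apply: measurable_funM.
- apply/measurable_EFinP; apply: measurableT_comp => //.
  by do ?[apply: measurable_funD|apply: measurable_funM|apply: measurable_cst].
- rewrite lee_fin (_ : (a * f x + g x) ^+ 2 =
    a ^+ 2 * (f x * f x) + (a *+ 2 * (f x * g x) + g x * g x)) ?ler_norm //.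
  by ring.
Qed.

Lemma ipC (R : realType) (f g : R -> R) : ip f g = ip g f.
Proof. by apply: eq_Rintegral => x _; rewrite mulrC. Qed.

Lemma ip_linr (R : realType) (a : R) (h f g : R -> R) :
  inL2 h -> inL2 f -> inL2 g ->
  ip h (fun x => a * f x + g x) = a * ip h f + ip h g.
Proof.
move=> Lh Lf Lg; rewrite /ip.
under eq_Rintegral do rewrite mulrDr mulrCA.
have i := inL2M_integrable.
rewrite RintegralD ?RintegralZl //; try exact: i.
exact: (integrableZl measurableT a (i _ _ _ Lh Lf)).
Qed.

Lemma ip_lin_sqr (R : realType) (a : R) (f g : R -> R) :
  inL2 f -> inL2 g ->
  ip (fun x => a * f x + g x) (fun x => a * f x + g x) =
  a ^+ 2 * ip f f + a *+ 2 * ip f g + ip g g.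
Proof.
move=> Lf Lg; have Lh := inL2_lin R a _ _ Lf Lg.
rewrite ip_linr // [ip _ f]ipC [ip _ g]ipC !ip_linr // [ip g f]ipC; ring.
Qed.

Lemma ip_ge0 (R : realType) (f : R -> R) : 0 <= ip f f.
Proof. by apply: Rintegral_ge0 => x _; rewrite -expr2 sqr_ge0. Qed.

Lemma L2norm_sqr (R : realType) (f : R -> R) : L2norm f ^+ 2 = ip f f.
Proof. by rewrite sqr_sqrtr // ip_ge0. Qed.

Lemma L2norm_ge0 (R : realType) (f : R -> R) : 0 <= L2norm f.
Proof. exact: sqrtr_ge0. Qed.

(** The squared norm of [a * f + g] is a nonnegative quadratic in [a]; it is evaluated at one
    well-chosen [a]. *)
Lemma ip_CauchySchwarz (R : realType) (f g : R -> R) : inL2 f -> inL2 g ->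
  `|ip f g| <= L2norm f * L2norm g.
Proof.
move=> Lf Lg.
rewrite -(@ler_pXn2r _ 2) ?nnegrE ?mulr_ge0 ?L2norm_ge0 //.
rewrite real_normK ?num_real // exprMn !L2norm_sqr.
have H a := ip_ge0 R (fun x => a * f x + g x).
have {}H (a : R) : 0 <= a ^+ 2 * ip f f + a *+ 2 * ip f g + ip g g.
  by rewrite -ip_lin_sqr.
have := ip_ge0 R f; rewrite le_eqVlt => /predU1P[f0|f0].
  rewrite -f0 mul0r; have [->|B0] := eqVneq (ip f g) 0; first by rewrite expr0n.
  (* With [ip f f = 0] the quadratic is affine in [a]; this [a] would give it the value [-1]. *)
  have := H (- (ip g g + 1) / (ip f g *+ 2)).
  rewrite -f0 mulr0 add0r.
  rewrite (_ : _ *+ 2 * _ = - (ip g g + 1)); first by lra.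
  by field; rewrite B0.
(* The minimiser of the quadratic; the factor [ip f f] clears the denominator. *)
have := mulr_ge0 (ltW f0) (H (- ip f g / ip f f)).
have -> : ip f f * ((- ip f g / ip f f) ^+ 2 * ip f f +
    (- ip f g / ip f f) *+ 2 * ip f g + ip g g) =
    ip f f * ip g g - ip f g ^+ 2 by field; rewrite gt_eqF.
by rewrite subr_ge0.
Qed.

Lemma L2norm_lin_le (R : realType) (a : R) (f g : R -> R) :
  inL2 f -> inL2 g ->
  L2norm (fun x => a * f x + g x) <= `|a| * L2norm f + L2norm g.
Proof.
move=> Lf Lg; have n0 := L2norm_ge0 R.
rewrite -(@ler_pXn2r _ 2) ?nnegrE ?addr_ge0 ?mulr_ge0 //.
rewrite L2norm_sqr ip_lin_sqr // sqrrD exprMn !L2norm_sqr real_normK ?num_real //.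
rewrite !lerD2 // mulrnAl lerMn2r /= -mulrA.
rewrite (le_trans (ler_norm _)) // normrM ler_wpM2l // ip_CauchySchwarz //.
Qed.

Lemma L2normZ (R : realType) (a : R) (f : R -> R) : inL2 f ->
  L2norm (fun x => a * f x) = `|a| * L2norm f.
Proof.
move=> Lf; rewrite -sqrtr_sqr -sqrtrM ?sqr_ge0 //; congr Num.sqrt.
rewrite -RintegralZl //; last exact: inL2M_integrable.
by apply: eq_Rintegral => x _; ring.
Qed.

Lemma inL2_0 (R : realType) : inL2 (fun _ : R => 0 : R).
Proof.
split; first exact: measurable_cst.
by under eq_integral do rewrite expr0n; rewrite integral0.
Qed.

Lemma inL2Z (R : realType) (a : R) (f : R -> R) : inL2 f ->
  inL2 (fun x => a * f x).
Proof.
move=> Lf; have := inL2_lin R a _ _ Lf (inL2_0 R).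
by under eq_fun do rewrite addr0.
Qed.

Lemma inL2_sum (R : realType) (n : nat) (c : nat -> R) (f : nat -> R -> R) :
  (forall k, inL2 (f k)) -> inL2 (fun x => \sum_(k < n) c k * f k x).
Proof.
move=> Lf; elim: n => [|n IH].
  under eq_fun do rewrite big_ord0.
  exact: inL2_0.
under eq_fun do rewrite big_ord_recr /= addrC.
exact: inL2_lin.
Qed.

Lemma ip_sumr (R : realType) (n : nat) (c : nat -> R) (h : R -> R)
    (f : nat -> R -> R) : inL2 h -> (forall k, inL2 (f k)) ->
  ip h (fun x => \sum_(k < n) c k * f k x) = \sum_(k < n) c k * ip h (f k).
Proof.
move=> Lh Lf; elim: n => [|n IH].
  rewrite big_ord0 /ip; under eq_Rintegral do rewrite big_ord0 mulr0.
  by rewrite Rintegral_cst // mul0r.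
under [X in ip h X]eq_fun do rewrite big_ord_recr /= addrC.
rewrite ip_linr //; last exact: inL2_sum.
by rewrite IH big_ord_recr addrC.
Qed.

(** * Indicators of intervals and translations *)

Lemma integral_indic_itv_sqr (R : realType) (a b : R) : a <= b ->
  (\int[@lebesgue_measure R]_x ((\1_(`[a, b]) x : R) ^+ 2)%:E = (b - a)%:E)%E.
Proof.
move=> ab; under eq_integral do rewrite expr2 indicE -natrM mulnb andbb -indicE.
rewrite integral_indic // setIT /= lebesgue_measure_itv /= lte_fin.
by case: ltgtP ab => // -> _; rewrite subrr.
Qed.

Lemma inL2_indic_itv (R : realType) (a b : R) : a <= b ->
  inL2 (\1_(`[a, b]) : R -> R).
Proof.
move=> ab; split; first exact: measurable_indic.
by rewrite integral_indic_itv_sqr // ltry.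
Qed.

Lemma L2norm_ind01 (R : realType) : L2norm (@ind01 R) = 1.
Proof.
rewrite /L2norm /ip /Rintegral /ind01.
under eq_integral do rewrite -expr2.
by rewrite integral_indic_itv_sqr // subr0 sqrtr1.
Qed.

(** By uniqueness of Lebesgue measure, it suffices to compare the two measures on half-open
    intervals. *)
Lemma lebesgue_measure_shift (R : realType) (r : R) (A : set R) :
  measurable A ->
  pushforward (@lebesgue_measure R) ((fun x => x + r) : _ -> measurableTypeR R) A
  = lebesgue_measure A.
Proof.
move=> mA; apply/esym/lebesgue_measure_unique; last exact: mA.
  exact: measurable_funD.
move=> mshift _ [[a b]] _ <-.
rewrite /= /pushforward.
rewrite (_ : _ @^-1` _ = `]a - r, b - r]%classic); last first.
  by apply/seteqP; split => x /=; rewrite !in_itv /= ltrBlDr lerBrDr.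
rewrite !lebesgue_measure_itv /= !lte_fin ltrD2r; case: ifP => // _.
by rewrite -!EFinB; congr EFin; ring.
Qed.

Lemma ge0_integral_shift (R : realType) (r : R) (f : R -> \bar R) :
  measurable_fun setT f -> (forall x, 0 <= f x)%E ->
  (\int[@lebesgue_measure R]_x f (x + r)%R = \int[@lebesgue_measure R]_x f x)%E.
Proof.
move=> mf f0.
have mshift : measurable_fun setT
    ((fun x => x + r)%R : measurableTypeR R -> measurableTypeR R).
  exact: measurable_funD.
transitivity (\int[pushforward (@lebesgue_measure R)
    ((fun x => x + r)%R : _ -> measurableTypeR R)]_x f x)%E.
  by rewrite ge0_integral_pushforward.
by apply: eq_measure_integral => A mA _; exact: lebesgue_measure_shift.
Qed.

Lemma inL2_shift (R : realType) (r : R) (f : R -> R) :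
  inL2 f -> inL2 (fun x => f (x + r)).
Proof.
move=> [mf f2]; split.
  by apply: measurableT_comp => //; exact: measurable_funD.
rewrite (@ge0_integral_shift R r (fun x => (f x ^+ 2)%:E)) //.
  by apply/measurable_EFinP; apply: measurable_funX.
by move=> x; rewrite lee_fin sqr_ge0.
Qed.

Lemma L2norm_shift (R : realType) (r : R) (f : R -> R) :
  inL2 f -> L2norm (fun x => f (x + r)) = L2norm f.
Proof.
move=> [mf f2]; rewrite /L2norm /ip /Rintegral.
rewrite (@ge0_integral_shift R r (fun x => (f x * f x)%:E)) //.
  by apply/measurable_EFinP; apply: measurable_funM.
by move=> x; rewrite lee_fin -expr2 sqr_ge0.
Qed.

(** * The operator [Abar] *)

Lemma inL2_g_n (R : realType) (K : R -> R) (T : R) (n : nat) :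
  inL2 (g_n K T n).
Proof.
apply: (@inL2_sum R n.+1 (fun k => k`!%:R * kappa K T n k)
  (fun k => \1_(`[- k%:R, - k%:R + 1]))) => k.
by apply: inL2_indic_itv; rewrite lerDl.
Qed.

Lemma inL2_ind01 (R : realType) : inL2 (@ind01 R).
Proof. exact: inL2_indic_itv. Qed.

Section Abar.
Context {R : realType}.
Variables (K : R -> R) (T beta : R) (n : nat).
Local Notation A := (Abar K T beta n).
Local Notation g := (g_n K T n).
Local Notation N := (Abar_norm K T beta n).

(** Puts [A f] in the shape [a * f + g] required by the lemmas on linear combinations. *)
Lemma AbarE (f : R -> R) :
  A f = (fun x => - (beta * ip g f) * ind01 x + f (x + 1)).
Proof. by apply/funext => x; rewrite /Abar addrC mulNr. Qed.

Lemma inL2_Abar (f : R -> R) : inL2 f -> inL2 (A f).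
Proof.
move=> Lf; rewrite AbarE.
by apply: inL2_lin; [exact: inL2_ind01|exact: inL2_shift].
Qed.

(** A crude bound, from the triangle inequality and Cauchy-Schwarz. It makes the set defining
    [Abar_norm] bounded, so that its [sup] is a true supremum, and it settles functions of norm
    zero. *)
Lemma L2norm_Abar_le (f : R -> R) : inL2 f ->
  L2norm (A f) <= (`|beta| * L2norm g + 1) * L2norm f.
Proof.
move=> Lf; rewrite AbarE.
have Lg := inL2_g_n R K T n.
apply: (le_trans (L2norm_lin_le _ _ _ _ (inL2_ind01 R) (inL2_shift R 1 _ Lf))).
rewrite L2norm_ind01 L2norm_shift // mulr1 normrN normrM mulrDl mul1r lerD2r.
by rewrite -mulrA ler_wpM2l // ip_CauchySchwarz.
Qed.

Lemma AbarZ (a : R) (f : R -> R) : inL2 f ->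
  A (fun x => a * f x) = (fun x => a * A f x).
Proof.
move=> Lf; apply/funext => x; rewrite /Abar.
have -> : ip g (fun x => a * f x) = a * ip g f.
  rewrite /ip -RintegralZl //; last exact: inL2M_integrable (inL2_g_n _ _ _ _) Lf.
  by apply: eq_Rintegral => y _; rewrite mulrCA.
by ring.
Qed.

Let Abar_ball :=
  [set L2norm (A f) | f in [set f | inL2 f /\ L2norm f <= 1]].

Let has_ubound_Abar_ball : has_ubound Abar_ball.
Proof.
exists (`|beta| * L2norm g + 1) => _ [f [Lf f1] <-].
apply: (le_trans (L2norm_Abar_le _ Lf)).
by rewrite ler_piMr // addr_ge0 // mulr_ge0 // L2norm_ge0.
Qed.

Lemma Abar_norm_ge0 : 0 <= N.
Proof.
apply: (le_trans (L2norm_ge0 R (A (@ind01 R)))).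
apply: ub_le_sup => //; exists (@ind01 R) => //.
by split; [exact: inL2_ind01|rewrite L2norm_ind01].
Qed.

Lemma L2norm_Abar_le_norm (f : R -> R) : inL2 f ->
  L2norm (A f) <= N * L2norm f.
Proof.
move=> Lf; have := L2norm_ge0 R f; rewrite le_eqVlt => /predU1P[f0|f0].
  (* A function of norm zero cannot be normalised; the crude bound shows that its image has norm
     zero too. *)
  by have := L2norm_Abar_le _ Lf; rewrite -f0 !mulr0.
have LAf := inL2_Abar _ Lf.
have fu : (L2norm f)^-1 * L2norm (A f) <= N.
  have e : `|(L2norm f)^-1| = (L2norm f)^-1 by rewrite gtr0_norm ?invr_gt0.
  apply: ub_le_sup => //; exists (fun x => (L2norm f)^-1 * f x).
    split; last by rewrite L2normZ // e mulVf ?gt_eqF.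
    exact: inL2Z.
  by rewrite AbarZ // L2normZ // e.
by rewrite -ler_pdivrMr // mulrC.
Qed.

Lemma inL2_iter_Abar (k : nat) : inL2 (iter k A (@ind01 R)).
Proof.
by elim: k => [|k IH] /=; [exact: inL2_ind01|exact: inL2_Abar].
Qed.

Lemma L2norm_iter_Abar (k : nat) : L2norm (iter k A (@ind01 R)) <= N ^+ k.
Proof.
elim: k => [|k IH] /=; first by rewrite L2norm_ind01 expr0.
apply: (le_trans (L2norm_Abar_le_norm _ (inL2_iter_Abar k))).
by rewrite exprS ler_wpM2l // Abar_norm_ge0.
Qed.

Lemma ip_iter_Abar_le (k : nat) :
  `|ip g (iter k A (@ind01 R))| <= L2norm g * N ^+ k.
Proof.
apply: (le_trans (ip_CauchySchwarz _ _ _ (inL2_g_n _ _ _ _) (inL2_iter_Abar k))).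
by rewrite ler_wpM2l ?L2norm_ge0 // L2norm_iter_Abar.
Qed.

(** The truncation at [M] includes the term of index [M], whereas [series] stops before its
    argument; hence [M.+1]. *)
Lemma ip_expAbar_partial (M : nat) (tau : R) :
  ip g (expAbar_partial K T beta n M tau) =
  series (fun k => tau ^+ k / k`!%:R * ip g (iter k A (@ind01 R))) M.+1.
Proof.
rewrite /expAbar_partial (ip_sumr _ M.+1 (fun k => tau ^+ k / k`!%:R) _
  (fun k => iter k A (@ind01 R))) ?seriesEord //.
  exact: inL2_g_n.
exact: inL2_iter_Abar.
Qed.

End Abar.

(** * The truncation error *)

(** Comparison with [C] times the exponential series gives absolute convergence and bounds each tail
    by the corresponding exponential tail. *)
Lemma series_exp_majorant (R : realType) (u : R ^nat) (C x : R) :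
  0 <= C -> 0 <= x -> (forall k, `|u k| <= C * (x ^+ k / k`!%:R)) ->
  cvgn (series u) /\ (forall m, `|limn (series u) - series u m| <=
    C * (expR x - series (exp_coeff x) m)).
Proof.
move=> C0 x0 ux.
have cv : cvgn (series u).
  apply: normed_cvg; apply: (@series_le_cvg _ _ (C *: exp_coeff x)).
  - by move=> k; exact: normr_ge0.
  - by move=> k; exact: le_trans (normr_ge0 _) (ux k).
  - exact: ux.
  - by apply: is_cvg_seriesZ; exact: is_cvg_series_exp_coeff.
split=> // m; have cvm : (fun k => `|series u k - series u m|) @ \oo -->
    `|limn (series u) - series u m|.
  by apply: cvg_norm; apply: cvgB => //; exact: cvg_cst.
(* The error is a limit of differences of partial sums, so it suffices to bound these for large
   [k]. *)
rewrite -(cvg_lim _ cvm) //; apply: limr_le; first by apply/cvg_ex; eexists; exact: cvm.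
near=> k; have mk : (m <= k)%N by near: k; exact: nbhs_infty_ge.
rewrite sub_series_geq //.
apply: (@le_trans _ _ (C * (series (exp_coeff x) k - series (exp_coeff x) m))).
  rewrite sub_series_geq // mulr_sumr (le_trans (ler_norm_sum _ _ _)) //.
  by apply: ler_sum.
rewrite ler_wpM2l // lerD2r.
apply: nondecreasing_cvgn_le; last exact: is_cvg_series_exp_coeff.
by apply: nondecreasing_series => i _ _; exact: exp_coeff_ge0.
Unshelve. all: by end_near. Qed.

(** This is [poisson_cdf_ge] multiplied by [expR x]. *)
Lemma expR_taylor_remainder_le (R : realType) (M : nat) (x : R) :
  0 <= x -> x <= M.+1%:R ->
  expR x - series (exp_coeff x) M.+1 <=
  expR x * (1 - expR (- (x / M.+1%:R))).
Proof.
move=> x0 xM; rewrite mulrBr mulr1 lerD2l lerN2.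
apply: (le_trans (ler_wpM2l (expR_ge0 x) (poisson_cdf_ge _ _ _ x0 xM))).
by rewrite mulrA -expRD subrr expR0 mul1r seriesEord.
Qed.

Theorem theorem3p4 (R : realType) (T alpha beta a1 a2 : R) (K : R -> R)
  (n : nat) :
  0 < T -> 0 < alpha -> 0 < beta -> 0 < a1 -> 0 < a2 ->
  {within `[0, T], continuous K} ->
  let N := Abar_norm K T beta n in
  let c := alpha * a2 / (2 * a1) in
  (forall (t : R) (M : nat), t \in `[0, T] -> (T - t) * N <= M%:R ->
     `|u_hat K T alpha beta a1 a2 n t - u_hatM K T alpha beta a1 a2 n M t|
       <= c * L2norm (g_n K T n) * expR ((T - t) * N)
            * (1 - expR (- ((T - t) * N / (M.+1)%:R)))) /\
  (forall M : nat, T * N <= M%:R ->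
     sup [set `|u_hat K T alpha beta a1 a2 n t - u_hatM K T alpha beta a1 a2 n M t|
           | t in `[0, T]]
       <= c * L2norm (g_n K T n) * expR (T * N)
            * (1 - expR (- (T * N / (M.+1)%:R)))) /\
  ((fun M : nat => c * L2norm (g_n K T n) * expR (T * N)
            * (1 - expR (- (T * N / (M.+1)%:R)))) @ \oo --> 0).
Proof.
move=> T0 alpha0 beta0 a10 a20 _ N c.
have c0 : 0 <= c by rewrite /c divr_ge0 ?mulr_ge0 // ltW.
have N0 : 0 <= N := Abar_norm_ge0 K T beta n.
have g0 : 0 <= L2norm (g_n K T n) := L2norm_ge0 R _.
have pointwise (t : R) (M : nat) : t \in `[0, T] -> (T - t) * N <= M%:R ->
     `|u_hat K T alpha beta a1 a2 n t - u_hatM K T alpha beta a1 a2 n M t|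
       <= c * L2norm (g_n K T n) * expR ((T - t) * N)
            * (1 - expR (- ((T - t) * N / (M.+1)%:R))).
  rewrite in_itv /= => /andP[_ tT] tM.
  have tau0 : 0 <= T - t by rewrite subr_ge0.
  rewrite /u_hat /u_hatM -/c -mulrBr normrM ger0_norm // -2!(mulrA c).
  rewrite -[X in c * X]mulrA ler_wpM2l //.
  set u := fun k : nat => (T - t) ^+ k / k`!%:R *
    ip (g_n K T n) (iter k (Abar K T beta n) (@ind01 R)).
  have le_u k : `|u k| <= L2norm (g_n K T n) * (((T - t) * N) ^+ k / k`!%:R).
    rewrite /u normrM [`|_ / _|]ger0_norm ?divr_ge0 ?exprn_ge0 //.
    rewrite exprMn [_ * N ^+ k / _]mulrAC mulrCA.
    by rewrite ler_wpM2l ?divr_ge0 ?exprn_ge0 // ip_iter_Abar_le.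
  have [cvu le_tail] := series_exp_majorant _ _ _ _ g0 (mulr_ge0 tau0 N0) le_u.
  rewrite ip_expAbar_partial -/u.
  have -> : (fun m => ip (g_n K T n) (expAbar_partial K T beta n m (T - t))) =
      (fun m => series u m.+1).
    by apply/funext => m; exact: ip_expAbar_partial.
  have -> : limn (fun m => series u m.+1) = limn (series u).
    by apply: cvg_lim => //; rewrite (cvg_shiftS (series u)).
  apply: (le_trans (le_tail _)).
  rewrite ler_wpM2l // expR_taylor_remainder_le ?mulr_ge0 //.
  by rewrite (le_trans tM) // ler_nat.
clearbody c N; split; [exact: pointwise|split].
- move=> M TM; apply: ge_sup.
    (* The set is nonempty: [t = 0] provides an element. *)
    by exists `|u_hat K T alpha beta a1 a2 n 0 - u_hatM K T alpha beta a1 a2 n M 0|;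
      exists 0 => //=; rewrite in_itv /= lexx ltW.
  move=> _ [t tT <-]; have /= := tT; rewrite in_itv /= => /andP[t0 _].
  have tN : (T - t) * N <= T * N by rewrite ler_wpM2r // gerBl.
  apply: (le_trans (pointwise t M tT (le_trans tN TM))).
  have tN0 : 0 <= (T - t) * N.
    by move: tT; rewrite /= in_itv /= => /andP[_ tT]; rewrite mulr_ge0 // subr_ge0.
  (* Both factors are nonnegative and increase with [(T - t) * N], so the bound is largest at
     [t = 0]. *)
  apply: ler_pM.
  + by rewrite mulr_ge0 ?mulr_ge0 // expR_ge0.
  + by rewrite subr_ge0 -expR0 ler_expR oppr_le0 divr_ge0.
  + by rewrite ler_wpM2l ?mulr_ge0 // ler_expR.
  + by rewrite lerD2l lerN2 ler_expR lerN2 ler_wpM2r ?invr_ge0.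
- have h : (fun M : nat => - (T * N / M.+1%:R)) @ \oo --> 0.
    rewrite -[X in _ --> X]oppr0; apply: cvgN.
    by rewrite -[X in _ --> X](mulr0 (T * N)); apply: cvgMr; exact: cvg_harmonic.
  have hE : (fun M : nat => 1 - expR (- (T * N / M.+1%:R))) @ \oo --> (0 : R).
    rewrite -[X in _ --> X](subrr (1 : R)); apply: cvgB; first exact: cvg_cst.
    rewrite -[X in _ --> X](@expR0 R).
    exact: (continuous_cvg _ (@continuous_expR R 0) h).
  by rewrite -[X in _ --> X](mulr0 (c * L2norm (g_n K T n) * expR (T * N)));
    apply: cvgMr.
Qed.
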